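(* Let $\Delta$ be a nice diagram with node set $\{1,\dots,n\}$. Let $\mathcal{J}_{\Delta,2}\subset\mathcal{J}_\Delta\subset\mathcal{I}_\Delta$ be such that $\mathcal{J}_{\Delta,2}$ parametrizes a maximal set of $\mathbb{Z}_2$-linearly independent rows of $M_{\Delta,2}$ and $\mathcal{J}_\Delta$ parametrizes a maximal set of $\mathbb{R}$-linearly independent rows of $M_\Delta$, and let $\mathring{W}=W\cap\mathring{V}_\Delta$, where $$W=\Big\{\sum_{I\in\mathcal{I}_\Delta} c_I E_I\in V_\Delta \;\Big|\; c_I=1\ \forall I\in\mathcal{J}_{\Delta,2},\ c_I=\pm1\ \forall I\in\mathcal{J}_\Delta\setminus\mathcal{J}_{\Delta,2}\Big\}.$$ Let $\operatorname{Aut}(\Delta)$ act on the set of connected components of $\mathring{W}$ (through its action on $\mathring{W}\cong\mathring{V}_\Delta/D_n$), and choose connected components $W_1,\dots,W_r$ of $\mathring{W}$, one for each orbit. Let $B_j\subset W_j$ be the subset defined by the Jacobi equations. Then: (1) each element of $B_j$ defines a nice nilpotent Lie algebra with diagram $\Delta$; (2) up to equivalence, any nice nilpotent Lie algebra with diagram $\Delta$ is obtained in this way, i.e. from an element of some $B_j$; (3) if $j\neq k$, elements of $B_j$ and of $B_k$ determine inequivalent nice Lie algebras.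
   Context: Nice Lie algebras. A nice basis of a finite-dimensional real Lie algebra $\mathfrak{g}$ is a basis $\{e_1,\dots,e_n\}$, with dual basis $\{e^1,\dots,e^n\}$, such that each $[e_i,e_j]$ is a (possibly zero) scalar multiple of a single basis element $e_k$ depending on $i,j$, and each interior product $e_i\lrcorner\, de^j$ is a (possibly zero) scalar multiple of a single $e^h$ depending on $i,j$, where $d$ is the Chevalley–Eilenberg differential. A nice nilpotent Lie algebra is a pair $(\mathfrak{g},\mathcal{B})$ with $\mathfrak{g}$ a real nilpotent Lie algebra and $\mathcal{B}$ a nice basis. Two such pairs are equivalent if there is a Lie algebra isomorphism mapping each element of the first basis to a nonzero multiple of an element of the second basis. Diagrams. A diagram is a finite directed acyclic graph with no multiple arrows with the same source and destination. A labeled diagram is a diagram with a function assigning to each arrow a node, called its label; $i\xrightarrow{j}k$ denotes an arrow from $i$ to $k$ with label $j$. An isomorphism of labeled diagrams is a graph isomorphism compatible with labels; $\operatorname{Aut}(\Delta)$ is the group of automorphisms of the labeled diagram $\Delta$, a subgroup of the permutation group of the nodes. The labeled diagram associated to $(\mathfrak{g},\mathcal{B})$ has nodes the elements of $\mathcal{B}$ and an arrow $e_i\xrightarrow{e_h}e_j$ whenever $e_j$ is a nonzero multiple of $[e_i,e_h]$; $(\mathfrak g,\mathcal B)$ has diagram $\Delta$ if its labeled diagram is isomorphic to $\Delta$. There is a double arrow $k\xrightarrow{i,j}h$ if $k\ne i,j$ and for some node $l$ both $k\xrightarrow{l}h$ and $i\xrightarrow{j}l$ are arrows. A nice diagram is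 a labeled diagram satisfying: (N1) two distinct arrows with the same source have different labels; (N2) two distinct arrows with the same destination have different labels; (N3) if $i\xrightarrow{j}k$ is an arrow, then $i\neq j$ and $j\xrightarrow{i}k$ is also an arrow; (N4) there do not exist four different nodes $i,j,k,v$ such that exactly one of $i\xrightarrow{j,k}v$, $j\xrightarrow{k,i}v$, $k\xrightarrow{i,j}v$ is a double arrow. The space $V_\Delta$. For a labeled diagram $\Delta$ with nodes $\{1,\dots,n\}$ satisfying (N1)–(N3), $\mathcal{I}_\Delta$ is the set of $I=\{\{i,j\},k\}$ with $i\xrightarrow{j}k$. For such $I$ with $i<j$, set $E_I=e^{ij}\otimes e_k\in\Lambda^2(\mathbb{R}^n)^*\otimes\mathbb{R}^n$, where $e^{ij}=e^i\wedge e^j$. $V_\Delta$ is the span of the $E_I$, $I\in\mathcal{I}_\Delta$, and $\mathring{V}_\Delta\subset V_\Delta$ is the set of $\sum c_IE_I$ with all $c_I\ne0$. An element $c=\sum c_IE_I$ determines $d\colon(\mathbb{R}^n)^*\to\Lambda^2(\mathbb{R}^n)^*$ by $de^k=\sum c_I\,e^{ij}$, the sum being over $I=\{\{i,j\},k\}\in\mathcal{I}_\Delta$ with $i<j$; the Jacobi equations are the polynomial equations in the $c_I$ expressing $d^2=0$ (with $d$ extended as a graded derivation). When they hold, $c$ defines a Lie algebra structure on $\mathbb{R}^n$, considered with its standard basis. Actions. $D_n$ is the group of invertible real diagonal $n\times n$ matrices acting on $V_\Delta$ as a subgroup of $\mathrm{GL}(n,\mathbb{R})$: $\operatorname{diag}(g_1,\dots,g_n)$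 sends $E_I$ to $\frac{g_k}{g_ig_j}E_I$ for $I=\{\{i,j\},k\}$. $\operatorname{Aut}(\Delta)$ acts on $V_\Delta$ by permutation of indices, $\sigma\cdot(e^{ij}\otimes e_k)=e^{\sigma(i)\sigma(j)}\otimes e_{\sigma(k)}$. Together these give an action of $\operatorname{Aut}(\Delta)\ltimes D_n$. The set $\mathring{W}$ meets each $D_n$-orbit in $\mathring{V}_\Delta$ in exactly one point, so $\operatorname{Aut}(\Delta)$ acts on $\mathring{W}\cong\mathring{V}_\Delta/D_n$; this action maps connected components to connected components. Root matrix. $M_\Delta$ is the matrix with rows indexed by $\mathcal{I}_\Delta$ (with a chosen total order) and $n$ columns, whose row indexed by $\{\{i,j\},k\}$ has entries $-1$ in columns $i$ and $j$, $+1$ in column $k$, and $0$ elsewhere. $M_{\Delta,2}$ is its reduction modulo $2$, with entries in $\mathbb{Z}_2$. *)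

(* Defs.v *)
From HB Require Import structures.
From mathcomp Require Import all_boot all_order all_algebra fingroup perm.
From mathcomp Require Import all_classical all_reals.
From mathcomp Require Import topology normedtype.

Set Implicit Arguments.
Unset Strict Implicit.
Unset Printing Implicit Defensive.

Import Order.TTheory GRing.Theory Num.Theory.
Import numFieldNormedType.Exports.
Local Open Scope ring_scope.

(** * Labeled diagrams *)

(* [dlabel D i k = Some j] means that there is an arrow from [i] to [k] and
   that its label is [j]; [None] means that there is no arrow. So there is at
   most one arrow from [i] to [k], and it has exactly one label. *)
Record labeled_diagram (N : finType) := LabeledDiagram {
  dlabel : N -> N -> option N;
  dlabel_acyclic : forall s : seq N,
    path.cycle (fun i k => dlabel i k != None) s -> s = [::] }.

Definition arrow (N : finType) (D : labeled_diagram N) (i j k : N) : bool :=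
  dlabel D i k == Some j.

Definition diagram_iso (N N' : finType) (D : labeled_diagram N)
    (D' : labeled_diagram N') (f : N -> N') : Prop :=
  bijective f /\ forall i k, dlabel D' (f i) (f k) = omap f (dlabel D i k).

Definition diagram_isomorphic (N N' : finType) (D : labeled_diagram N)
    (D' : labeled_diagram N') : Prop :=
  exists f : N -> N', diagram_iso D D' f.

Definition diagram_aut (N : finType) (D : labeled_diagram N) (s : {perm N}) :=
  diagram_iso D D s.

(* the double arrow k --(i,j)--> h *)
Definition double_arrow (N : finType) (D : labeled_diagram N) (k i j h : N) :
    bool :=
  [&& k != i, k != j & [exists l, arrow D k l h && arrow D i j l]].

Record nice_diagram (N : finType) (D : labeled_diagram N) : Prop := {
  nice_N1 : forall i j k k', arrow D i j k -> arrow D i j k' -> k = k';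
  nice_N2 : forall i i' j k, arrow D i j k -> arrow D i' j k -> i = i';
  nice_N3 : forall i j k, arrow D i j k -> i != j /\ arrow D j i k;
  nice_N4 : forall i j k v, uniq [:: i; j; k; v] ->
    (double_arrow D i j k v + double_arrow D j k i v
       + double_arrow D k i j v)%N != 1%N }.

(** * Real Lie algebras and nice bases *)

Section LieAlgebras.
Variable R : realType.

Record lie_bracket (V : vectType R) (br : V -> V -> V) : Prop := {
  lie_linearl : forall z, linear (fun x => br x z);
  lie_linearr : forall z, linear (br z);
  lie_alternating : forall x, br x x = 0;
  lie_jacobi : forall x y z,
    br x (br y z) + br y (br z x) + br z (br x y) = 0 }.

(* lower central series; by bilinearity, brackets of basis vectors suffice *)
Fixpoint lower_central (V : vectType R) (br : V -> V -> V) (k : nat) :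
    {vspace V} :=
  if k is k'.+1 then
    <<[seq br x y | x <- vbasis fullv, y <- vbasis (lower_central br k')]>>%VS
  else fullv.

Definition nilpotent_lie (V : vectType R) (br : V -> V -> V) : Prop :=
  exists k, lower_central br k = 0%VS.

(* Chevalley-Eilenberg differential of a linear form *)
Definition ce_d (V : vectType R) (br : V -> V -> V) (alpha : V -> R) (x y : V) :
    R :=
  - alpha (br x y).

(* [coord e j] is the dual basis element e^j. *)
Record nice_basis (n : nat) (V : vectType R) (br : V -> V -> V)
    (e : n.-tuple V) : Prop := {
  nice_is_basis : basis_of fullv e;
  nice_bracket : forall i j, exists k a,
    br (tnth e i) (tnth e j) = a *: tnth e k;
  nice_interior : forall i j, exists h a, forall y,
    ce_d br (coord e j) (tnth e i) y = a * coord e h y }.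

Record nice_nilpotent (n : nat) (V : vectType R) (br : V -> V -> V)
    (e : n.-tuple V) : Prop := {
  nn_lie : lie_bracket br;
  nn_nilpotent : nilpotent_lie br;
  nn_nice : nice_basis br e }.

Definition nice_equivalent (n m : nat) (V V' : vectType R)
    (br : V -> V -> V) (e : n.-tuple V)
    (br' : V' -> V' -> V') (e' : m.-tuple V') : Prop :=
  exists f : 'Hom(V, V'),
    [/\ bijective f,
        forall x y, f (br x y) = br' (f x) (f y) &
        forall i, exists j a, a != 0 /\ f (tnth e i) = a *: tnth e' j].

(* Nodes of the diagram of (V, e) are basis vectors, given by their index. *)
Definition diagram_of (n : nat) (V : vectType R) (br : V -> V -> V)
    (e : n.-tuple V) (D : labeled_diagram 'I_n) : Prop :=
  forall i h j, arrow D i h j <->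
    exists a : R, a != 0 /\ tnth e j = a *: br (tnth e i) (tnth e h).

Definition has_diagram (m : nat) (V : vectType R) (br : V -> V -> V)
    (e : m.-tuple V) (n : nat) (D : labeled_diagram 'I_n) : Prop :=
  exists D' : labeled_diagram 'I_m,
    diagram_of br e D' /\ diagram_isomorphic D' D.

End LieAlgebras.

(** * Index set and root matrix *)

Section Indices.
Variables (n : nat) (D : labeled_diagram 'I_n).

(* An index {{i,j},k} is represented by the triple ((i,j),k) with i < j; under
   (N3) this is a bijective encoding. *)
Definition root_index : finType :=
  {t : 'I_n * 'I_n * 'I_n | (t.1.1 < t.1.2)%N && arrow D t.1.1 t.1.2 t.2}.

Definition src1 (I : root_index) : 'I_n := (val I).1.1.
Definition src2 (I : root_index) : 'I_n := (val I).1.2.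
Definition tgt (I : root_index) : 'I_n := (val I).2.

(* The order on the rows is the one of [enum root_index]. *)
Definition root_matrix : 'M[int]_(#|root_index|, n) :=
  \matrix_(a, m)
    (if m == tgt (enum_val a) then 1
     else if (m == src1 (enum_val a)) || (m == src2 (enum_val a)) then -1
     else 0).

(* For F := 'F_2 this is about the reduction of the root matrix modulo 2. *)
Definition rows_independent (F : fieldType) (J : {set root_index}) : bool :=
  free [seq row (enum_rank t) (map_mx intr root_matrix : 'M[F]_(_, n))
       | t <- enum J].

Definition max_independent_rows (F : fieldType) (J : {set root_index}) : bool :=
  maxset (@rows_independent F) J.

End Indices.

(** * The space V_Delta *)

Section Tensors.
Variables (R : realType) (n : nat).

(* An element c of Lambda^2(R^n)^* (x) R^n is represented by its components
   along e_0, ..., e_{n-1}: [c k] is the skew-symmetric matrix of the 2-form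
   that multiplies e_k, i.e., of de^k. *)
Definition tensor : Type := 'I_n -> 'M[R]_n.

Definition wedge2 (i j : 'I_n) : 'M[R]_n := delta_mx i j - delta_mx j i.

(* diag(g) acts on Lambda^2(R^n)^* (x) R^n as an element of GL(n,R). *)
Definition diag_act (g : 'I_n -> R) (c : tensor) : tensor :=
  fun k => \matrix_(i, j) (g k / (g i * g j) * c k i j).

(* e^{ij} (x) e_k is sent to e^{s i, s j} (x) e_{s k}. *)
Definition perm_act (s : 'S_n) (c : tensor) : tensor :=
  fun k => \matrix_(i, j) c ((s^-1)%g k) ((s^-1)%g i) ((s^-1)%g j).

Definition form2 (w : 'M[R]_n) (x y : 'rV[R]_n) : R := (x *m w *m y^T) 0 0.

Definition wedge21 (w : 'M[R]_n) (l : 'I_n) (x y z : 'rV[R]_n) : R :=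
  form2 w x y * z 0 l + form2 w y z * x 0 l + form2 w z x * y 0 l.

Definition wedge12 (l : 'I_n) (w : 'M[R]_n) (x y z : 'rV[R]_n) : R :=
  x 0 l * form2 w y z + y 0 l * form2 w z x + z 0 l * form2 w x y.

(* Extension of de^k = c k to 2-forms as a graded derivation:
   d(e^i /\ e^j) = de^i /\ e^j - e^i /\ de^j. *)
Definition d_2form (c : tensor) (w : 'M[R]_n) (x y z : 'rV[R]_n) : R :=
  \sum_(i < n) \sum_(j < n | (i < j)%N)
     w i j * (wedge21 (c i) j x y z - wedge12 i (c j) x y z).

Definition jacobi_equations (c : tensor) : Prop :=
  forall k x y z, d_2form c (c k) x y z = 0.

(* The bracket whose Chevalley-Eilenberg differential is de^k = c k, that is,
   e^k([x,y]) = - de^k(x,y). *)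
Definition tensor_bracket (c : tensor) (x y : 'rV[R]_n) : 'rV[R]_n :=
  \row_k - form2 (c k) x y.

Definition std_basis : n.-tuple 'rV[R]_n := [tuple delta_mx 0 i | i < n].

End Tensors.

Section Components.
Local Open Scope classical_set_scope.
Variables (R : realType) (n : nat) (D : labeled_diagram 'I_n).
Implicit Types (I : root_index D) (J : {set root_index D}).

Definition E_ I : tensor R n :=
  fun k => if k == tgt I then wedge2 R (src1 I) (src2 I) else 0.

(* sum_I a_I E_I *)
Definition lincomb_E (a : root_index D -> R) : tensor R n :=
  fun k => \sum_(I : root_index D) a I *: E_ I k.

Definition V_open : set (tensor R n) :=
  [set c | exists2 a, (forall I, a I != 0) & c = lincomb_E a].

Definition W_set J2 J : set (tensor R n) :=
  [set c | exists2 a,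
     (forall I, I \in J2 -> a I = 1) /\
     (forall I, I \in J :\: J2 -> a I = 1 \/ a I = -1) &
     c = lincomb_E a].

Definition W_open J2 J : set (tensor R n) := W_set J2 J `&` V_open.

(* Function types have no default topology in the library; here it is the
   product one, so that [tensor] has the usual topology of a
   finite-dimensional real vector space. *)
Definition is_component (A C : set (tensor R n)) : Prop :=
  exists2 c, A c & C = @connected_component {ptws 'I_n -> 'M[R]_n} A c.

(* Image of C under the action of s on [W_open J2 J], identified with the set
   of diagonal orbits in [V_open]: w is sent to the element of [W_open J2 J]
   that lies in the orbit of [perm_act s w]. *)
Definition aut_image J2 J (s : 'S_n) (C : set (tensor R n)) :
    set (tensor R n) :=
  [set w' | W_open J2 J w' /\
     exists2 w, C w & exists2 g : 'I_n -> R, (forall i, g i != 0) &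
       w' = diag_act g (perm_act s w)].

Definition jacobi_subset (C : set (tensor R n)) : set (tensor R n) :=
  C `&` [set c | jacobi_equations c].

Definition same_orbit J2 J (C C' : set (tensor R n)) : Prop :=
  exists2 s : 'S_n, diagram_aut D s & aut_image J2 J s C = C'.

End Components.

(* Main.v *)
(** A tensor supported exactly on the arrows of D is a nice nilpotent Lie
    algebra with diagram D as soon as it satisfies the Jacobi equations:
    acyclicity makes the number of ancestors strictly increase along brackets.

    A diagonal change of basis diag(g) multiplies c_I by g_k / (g_i g_j). On
    absolute values this is, after taking logarithms, the linear functional
    given by the row I of the root matrix over R; on signs it is the one given
    by the row I over F_2. Independence of the rows in J (over R) and in J2
    (over F_2) therefore lets one normalize any structure into W_open, while
    maximality of J2 implies that the signs on J2 determine all the signs.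

    A component of W_open is the set of its points with prescribed signs (any
    two of them are joined by a segment, since the coordinates in J are fixed by
    their signs). Hence an automorphism of D followed by normalization maps
    components onto components, and since an equivalence of nice Lie algebras
    with diagram D is an automorphism of D followed by a diagonal matrix, the
    equivalence classes are seen on representatives of the orbits. *)

From HB Require Import structures.
Require Import Defs.
From mathcomp Require Import all_boot all_order all_algebra fingroup perm.
From mathcomp Require Import all_classical all_reals.
From mathcomp Require Import topology normedtype sequences exp.
From mathcomp Require Import ring lra.

Set Implicit Arguments.
Unset Strict Implicit.
Unset Printing Implicit Defensive.

Import Order.TTheory GRing.Theory Num.Theory.
Import numFieldNormedType.Exports.
Local Open Scope ring_scope.
Local Open Scope classical_set_scope.

(** * The bracket of a tensor *)

Section TensorBracket.
Variables (R : realType) (n : nat).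
Implicit Types (c : tensor R n) (x y z : 'rV[R]_n).

Definition skew_tensor c := forall k i j, c k j i = - c k i j.

Lemma form2E (w : 'M[R]_n) x y :
  form2 w x y = \sum_i \sum_j x 0 i * w i j * y 0 j.
Proof.
rewrite /form2 mxE exchange_big /=; apply: eq_bigr => j _.
by rewrite mxE mulr_suml; apply: eq_bigr => i _; rewrite mxE.
Qed.

Lemma form2_linearl (w : 'M[R]_n) y : linear (fun x => form2 w x y : R^o).
Proof. by move=> a u v; rewrite /form2 !mulmxDl -!scalemxAl !mxE. Qed.

Lemma form2_linearr (w : 'M[R]_n) x : linear (form2 w x : _ -> R^o).
Proof. by move=> a u v; rewrite /form2 linearP mulmxDr -!scalemxAr !mxE. Qed.

Lemma form2_skew c k x y : skew_tensor c -> form2 (c k) y x = - form2 (c k) x y.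
Proof.
move=> sk; rewrite !form2E exchange_big -sumrN; apply: eq_bigr => i _.
rewrite -sumrN; apply: eq_bigr => j _.
by rewrite sk mulrN mulNr -!mulrA (mulrC (y 0 j)) (mulrC (c k i j)) -!mulrA.
Qed.

Lemma form2_delta (w : 'M[R]_n) i j :
  form2 w (delta_mx 0 i) (delta_mx 0 j) = w i j.
Proof. by rewrite /form2 -rowE trmx_delta -colE !mxE. Qed.

Lemma tensor_bracket_linearl c y : linear (tensor_bracket c ^~ y).
Proof.
move=> a u v; apply/rowP => k; rewrite !mxE.
by rewrite [form2 _ _ _]form2_linearl opprD mulrN.
Qed.

Lemma tensor_bracket_linearr c x : linear (tensor_bracket c x).
Proof.
move=> a u v; apply/rowP => k; rewrite !mxE.
by rewrite [form2 _ _ _]form2_linearr opprD mulrN.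
Qed.

Lemma tensor_bracketZZ c a b x y :
  tensor_bracket c (a *: x) (b *: y) = (a * b) *: tensor_bracket c x y.
Proof.
apply/rowP => k; rewrite [LHS]mxE [RHS]mxE [in RHS]mxE /form2.
by rewrite linearZ /= -scalemxAl -scalemxAl -scalemxAr mxE mxE mulrN mulrA.
Qed.

Lemma tensor_bracket_skew c x y : skew_tensor c ->
  tensor_bracket c y x = - tensor_bracket c x y.
Proof. by move=> sk; apply/rowP => k; rewrite !mxE form2_skew. Qed.

Lemma tensor_bracket_alternating c x : skew_tensor c ->
  tensor_bracket c x x = 0.
Proof.
move=> sk; apply/rowP => k; rewrite !mxE.
have /eqP := form2_skew k x x sk.
by rewrite -addr_eq0 -mulr2n mulrn_eq0 /= => /eqP ->; rewrite oppr0.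
Qed.

Lemma tensor_bracket_delta c i j k :
  tensor_bracket c (delta_mx 0 i) (delta_mx 0 j) 0 k = - c k i j.
Proof. by rewrite mxE form2_delta. Qed.

(** Skewness turns [- w i j * F j i] into the contribution of the transposed pair [(j, i)], and the
    diagonal contributes nothing because [w i i = 0]. *)
Lemma skew_sum_lt (w : 'M[R]_n) (F : 'I_n -> 'I_n -> R) :
  (forall i j, w j i = - w i j) ->
  \sum_(i < n) \sum_(j < n | (i < j)%N) w i j * (F i j - F j i) =
  \sum_i \sum_j w i j * F i j.
Proof.
move=> sk.
have w0 i : w i i = 0.
  by have /eqP := sk i i; rewrite -addr_eq0 -mulr2n mulrn_eq0 => /eqP.
transitivity (\sum_(i < n) (\sum_(j < n | (i < j)%N) w i j * F i j +
                            \sum_(j < n | (j < i)%N) w i j * F i j)).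
  rewrite big_split /= [X in _ = _ + X](exchange_big_dep xpredT) //=.
  rewrite -big_split; apply: eq_bigr => i _; rewrite -big_split /=.
  by apply: eq_bigr => j _; rewrite [w j i]sk mulrBr mulNr.
apply: eq_bigr => i _; rewrite [RHS](bigID (fun j : 'I_n => (i < j)%N)) /=.
congr (_ + _); rewrite [RHS](bigD1 i) ?ltnn //= w0 mul0r add0r.
by apply: eq_bigl => j; rewrite -leqNgt ltn_neqAle andbC.
Qed.

(** The bracket is minus the differential in each coordinate; nesting two brackets cancels the sign,
    so the second differential of e^k is the coordinate [k] of the Jacobiator. *)
Lemma d_2formE c k x y z : skew_tensor c ->
  d_2form c (c k) x y z =
    (tensor_bracket c (tensor_bracket c x y) z +
     tensor_bracket c (tensor_bracket c y z) x +
     tensor_bracket c (tensor_bracket c z x) y) 0 k.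
Proof.
move=> sk; pose F i j := wedge21 (c i) j x y z.
transitivity (\sum_i \sum_j c k i j * F i j).
  (* A 1-form and a 2-form commute under the wedge product, so the subtracted term is [F j i]. *)
  rewrite -(skew_sum_lt _ (sk k)); apply: eq_bigr => i _; apply: eq_bigr => j _.
  by congr (_ * (_ - _)); rewrite /F /wedge21 /wedge12; ring.
rewrite !mxE !form2E -!sumrN -!big_split; apply: eq_bigr => i _ /=.
rewrite -!sumrN -!big_split; apply: eq_bigr => j _ /=.
rewrite /F /wedge21 !mxE !mulrDr !mulNr !opprK.
by congr (_ + _ + _); rewrite mulrA (mulrC (c k i j)).
Qed.

Lemma jacobi_equationsP c : skew_tensor c ->
  jacobi_equations c <->
  forall x y z, tensor_bracket c x (tensor_bracket c y z) +
    tensor_bracket c y (tensor_bracket c z x) +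
    tensor_bracket c z (tensor_bracket c x y) = 0.
Proof.
move=> sk.
have E x y z : tensor_bracket c x (tensor_bracket c y z) +
    tensor_bracket c y (tensor_bracket c z x) +
    tensor_bracket c z (tensor_bracket c x y) =
   - (tensor_bracket c (tensor_bracket c x y) z +
     tensor_bracket c (tensor_bracket c y z) x +
     tensor_bracket c (tensor_bracket c z x) y).
  rewrite [tensor_bracket c x _]tensor_bracket_skew //.
  rewrite [tensor_bracket c y (tensor_bracket _ _ _)]tensor_bracket_skew //.
  rewrite [tensor_bracket c z (tensor_bracket _ _ _)]tensor_bracket_skew //.
  by rewrite -!opprD [X in - X = _]addrC addrA.
split=> [jac x y z|jac k x y z].
  rewrite E; apply/eqP; rewrite oppr_eq0; apply/eqP/rowP => k.
  by rewrite -d_2formE // jac mxE.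
by rewrite d_2formE // -[X in fun_of_matrix X]opprK -E jac oppr0 mxE.
Qed.

End TensorBracket.

(** * Tensors supported on the arrows of a nice diagram *)

Section Support.
Variables (R : realType) (n : nat) (D : labeled_diagram 'I_n).
Hypothesis niceD : nice_diagram D.
Implicit Types (c : tensor R n) (I : root_index D) (a : root_index D -> R).

(** Entrywise form of membership in [V_open], free of coefficient families; [V_openP] gives the
    equivalence. *)
Definition full_support c :=
  skew_tensor c /\ forall k i j, (c k i j != 0) = arrow D i j k.

Definition coef c I : R := c (tgt I) (src1 I) (src2 I).

Lemma full_support0 c k i j : full_support c -> ~~ arrow D i j k -> c k i j = 0.
Proof. by case=> _ supp; rewrite -supp negbK => /eqP. Qed.

Lemma src_lt I : (src1 I < src2 I)%N.
Proof. by have /andP[] := valP I. Qed.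

Lemma arrow_root I : arrow D (src1 I) (src2 I) (tgt I).
Proof. by have /andP[] := valP I. Qed.

Lemma root_index_inj I I' :
  tgt I = tgt I' -> src1 I = src1 I' -> src2 I = src2 I' -> I = I'.
Proof.
move=> et e1 e2; apply: val_inj; move: et e1 e2; rewrite /tgt /src1 /src2.
by case: (val I) => [[a b] d]; case: (val I') => [[a' b'] d'] /= -> -> ->.
Qed.

Lemma root_indexE (i j k : 'I_n) : (i < j)%N -> arrow D i j k ->
  exists I, [/\ tgt I = k, src1 I = i & src2 I = j].
Proof.
move=> ij ar; have t : ((i, j, k).1.1 < (i, j, k).1.2)%N &&
    arrow D (i, j, k).1.1 (i, j, k).1.2 (i, j, k).2 by rewrite ij.
by exists (Sub (i, j, k) t); rewrite /tgt /src1 /src2 SubK.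
Qed.

Lemma arrowC i j k : arrow D i j k = arrow D j i k.
Proof. by apply/idP/idP => /(nice_N3 niceD)[]. Qed.

Lemma arrow_neq i j k : arrow D i j k -> i != j.
Proof. by move=> /(nice_N3 niceD)[]. Qed.

Lemma arrow_label_inj i j j' k : arrow D i j k -> arrow D i j' k -> j = j'.
Proof. by rewrite /arrow => /eqP -> /eqP[]. Qed.

Lemma arrow_src_neq i j k : arrow D i j k -> k != i.
Proof.
move=> ar; apply/eqP => ki; move/eqP: ar; rewrite ki => E.
by have := @dlabel_acyclic _ D [:: i]; rewrite /= E => /(_ isT).
Qed.

Lemma lincomb_EE a k i j :
  lincomb_E a k i j = \sum_I a I * ((k == tgt I)%:R *
   (((i == src1 I) && (j == src2 I))%:R -
    ((i == src2 I) && (j == src1 I))%:R)) :> R.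
Proof.
rewrite /lincomb_E summxE; apply: eq_bigr => I _; rewrite mxE /E_.
by case: eqP => _; rewrite ?mul1r ?mul0r /wedge2 !mxE.
Qed.

(** The order of the two sources keeps the entry read by [coef] away from the transposed half of
    every [wedge2], so the functionals [coef] are dual to the [E_ I]. *)
Lemma coef_lincomb a I : coef (lincomb_E a) I = a I.
Proof.
rewrite /coef lincomb_EE (bigD1 I) //= !eqxx /= big1 ?addr0 => [|I' nI].
  have := src_lt I; case: eqP => [->|_]; rewrite ?ltnn //.
  by rewrite /= subr0 !mulr1.
case: eqP => [et|_]; last by rewrite mul0r mulr0.
case: eqP => [e1|_] /=.
  case: eqP => [e2|_].
    by rewrite (root_index_inj et e1 e2) eqxx in nI.
  by have := src_lt I'; rewrite -e1; case: eqP => [->|];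
    rewrite ?ltnn //= subr0 !mulr0.
case: eqP => [e1|_] /=; last by rewrite subr0 !mulr0.
case: eqP => [e2|_] /=; last by rewrite subr0 !mulr0.
by have := src_lt I; have := src_lt I'; rewrite e1 e2 => /ltn_trans h /h;
  rewrite ltnn.
Qed.

Lemma lincomb_skew a : skew_tensor (lincomb_E a : tensor R n).
Proof.
move=> k i j; rewrite !lincomb_EE -sumrN; apply: eq_bigr => I _.
rewrite -mulrN -[in RHS]mulrN opprB; congr (_ * (_ * (_ - _))).
  by rewrite andbC.
by rewrite andbC.
Qed.

Lemma lincomb_supp a k i j : ~~ arrow D i j k -> lincomb_E a k i j = 0 :> R.
Proof.
move=> na; rewrite lincomb_EE big1 // => I _.
case: eqP => [et|_]; last by rewrite mul0r mulr0.
have [/andP[/eqP e1 /eqP e2]|_] := boolP (_ && _).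
  by rewrite e1 e2 et arrow_root in na.
have [/andP[/eqP e1 /eqP e2]|_] := boolP (_ && _).
  by rewrite arrowC e1 e2 et arrow_root in na.
by rewrite subr0 !mulr0.
Qed.

Lemma skew_diag0 c k i : skew_tensor c -> c k i i = 0.
Proof.
by move=> sk; have /eqP := sk k i i; rewrite -addr_eq0 -mulr2n mulrn_eq0 =>
  /eqP.
Qed.

Lemma tensor_ext c c' : skew_tensor c -> skew_tensor c' ->
  (forall k i j, ~~ arrow D i j k -> c k i j = 0) ->
  (forall k i j, ~~ arrow D i j k -> c' k i j = 0) ->
  coef c =1 coef c' -> c = c'.
Proof.
move=> sk sk' c0 c0' cc; apply/funext => k; apply/matrixP.
have lt (i j : 'I_n) : (i < j)%N -> c k i j = c' k i j.
  move=> ij; have [ar|na] := boolP (arrow D i j k); last by rewrite c0 ?c0'.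
  by have [I [<- <- <-]] := root_indexE ij ar; exact: cc.
move=> i j; case: (ltngtP i j) => [/lt //|ji|/val_inj ->].
  by rewrite sk sk' lt.
by rewrite !skew_diag0.
Qed.

Lemma coefK c : full_support c -> lincomb_E (coef c) = c.
Proof.
move=> fc; apply: tensor_ext; [exact: lincomb_skew|by case: fc| | |].
- by move=> k i j; exact: lincomb_supp.
- by move=> k i j; exact: full_support0.
- by move=> I; rewrite coef_lincomb.
Qed.

Lemma coef_neq0 c I : full_support c -> coef c I != 0.
Proof. by case=> _ supp; rewrite supp arrow_root. Qed.

(** By (N3) the set of arrows is symmetric in source and label and avoids the diagonal, as the
    support of a skew tensor must. *)
Lemma V_openP c : V_open D c <-> full_support c.
Proof.
split=> [[a a0 ->]|fc]; last first.
  by exists (coef c); [move=> I; exact: coef_neq0|rewrite coefK].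
split; first exact: lincomb_skew.
have sk := lincomb_skew a.
move=> k i j; have [ar|/lincomb_supp ->] := boolP (arrow D i j k);
  last by rewrite eqxx.
case: (ltngtP i j) => [ij|ji|/val_inj ij].
- by have [I [<- <- <-]] := root_indexE ij ar; rewrite
    [fun_of_matrix _ _ _]coef_lincomb a0.
- rewrite arrowC in ar; rewrite sk oppr_eq0.
  by have [I [<- <- <-]] := root_indexE ji ar; rewrite
    [fun_of_matrix _ _ _]coef_lincomb a0.
- by have := arrow_neq ar; rewrite ij eqxx.
Qed.

Lemma W_openP (J2 J : {set root_index D}) c :
  W_open J2 J c <-> [/\ full_support c, forall I, I \in J2 -> coef c I = 1 &
    forall I, I \in J :\: J2 -> coef c I = 1 \/ coef c I = -1].
Proof.
split=> [[[a [a1 a2] ->] /V_openP fc]|[fc c1 c2]].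
  by split=> // I; rewrite coef_lincomb; [exact: a1|exact: a2].
by split; [exists (coef c)|apply/V_openP] => //; rewrite coefK.
Qed.

Lemma full_support_diag g c : (forall i, g i != 0) -> full_support c ->
  full_support (diag_act g c).
Proof.
move=> g0 [sk supp]; split=> k i j; rewrite !mxE.
  by rewrite sk mulrN [g i * g j]mulrC.
by rewrite -supp mulf_eq0 negb_or mulf_eq0 invr_eq0 mulf_eq0 !negb_or !g0.
Qed.

Lemma full_support_perm s c : diagram_aut D s -> full_support c ->
  full_support (perm_act s c).
Proof.
move=> [_ As] [sk supp]; split=> k i j; rewrite !mxE; first exact: sk.
rewrite supp; set i' := (s^-1)%g i; set j' := (s^-1)%g j; set k' := (s^-1)%g k.
rewrite -[i](permKV s) -[j](permKV s) -[k](permKV s) -/i' -/j' -/k' /arrow As.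
by case: (dlabel D i' k') => [l|] //=; rewrite !(inj_eq (@Some_inj _))
  (inj_eq perm_inj).
Qed.

Lemma coef_diag g c I :
  coef (diag_act g c) I = g (tgt I) / (g (src1 I) * g (src2 I)) * coef c I.
Proof. by rewrite /coef mxE. Qed.

Lemma diag_actM g h c : diag_act g (diag_act h c) = diag_act (fun i =>
  g i * h i) c.
Proof.
apply/funext => k; apply/matrixP => i j; rewrite !mxE.
by rewrite mulrA mulrACA -invfM (mulrACA (g i)).
Qed.

Lemma diag_act1 c : diag_act (fun=> 1) c = c.
Proof.
by apply/funext => k; apply/matrixP => i j; rewrite !mxE mulr1 divr1 mul1r.
Qed.

Lemma diag_actK g c : (forall i, g i != 0) ->
  diag_act (fun i => (g i)^-1) (diag_act g c) = c.
Proof.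
move=> g0; rewrite diag_actM -[RHS]diag_act1; congr diag_act.
by apply/funext => i; rewrite mulVf.
Qed.

Lemma perm_diag_act s g c :
  perm_act s (diag_act g c) = diag_act (fun i => g ((s^-1)%g i)) (perm_act s c).
Proof. by apply/funext => k; apply/matrixP => i j; rewrite !mxE. Qed.

Lemma perm_actK s c : perm_act (s^-1)%g (perm_act s c) = c.
Proof.
by apply/funext => k; apply/matrixP => i j; rewrite !mxE invgK !permK.
Qed.

Lemma perm_actKV s c : perm_act s (perm_act (s^-1)%g c) = c.
Proof.
by apply/funext => k; apply/matrixP => i j; rewrite !mxE invgK !permKV.
Qed.

Lemma diagram_autV (s : 'S_n) : diagram_aut D s -> diagram_aut D (s^-1)%g.
Proof.
move=> [bs As]; split.
  by exists s => x; [exact: permKV|exact: permK].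
move=> i k; have := As ((s^-1)%g i) ((s^-1)%g k); rewrite !permKV => ->.
by case: (dlabel D _ _) => //= l; rewrite permK.
Qed.

(** * Nilpotency from acyclicity *)

Section Nilpotent.
Variable c : tensor R n.
Hypothesis fc : full_support c.

(** By (N1) source and label determine the target, so only one coordinate survives. *)
Lemma tensor_bracket_arrow i j k : arrow D i j k ->
  tensor_bracket c (delta_mx 0 i) (delta_mx 0 j) = - c k i j *: delta_mx 0 k.
Proof.
move=> ar; apply/rowP => l; rewrite tensor_bracket_delta !mxE eqxx /=.
case: eqP => [->|nlk]; first by rewrite mulr1.
rewrite mulr0 (@full_support0 c) ?oppr0 //.
by apply/negP => /(nice_N1 niceD ar) /esym.
Qed.

Lemma tensor_bracket_noarrow i j : (forall k, ~~ arrow D i j k) ->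
  tensor_bracket c (delta_mx 0 i) (delta_mx 0 j) = 0.
Proof.
move=> na; apply/rowP => l.
by rewrite tensor_bracket_delta (@full_support0 c) ?oppr0 ?mxE.
Qed.

Definition ancestors (k : 'I_n) : {set 'I_n} :=
  [set i | connect (fun i k => dlabel D i k != None) i k]%SET.

(** Transitivity gives the inclusion. It is strict at [k], since a path from [k] back to [i] would
    be closed by the arrow into a cycle. *)
Lemma ancestors_arrow i j k : arrow D i j k ->
  (#|ancestors i| < #|ancestors k|)%N.
Proof.
move=> ar; have eik : dlabel D i k != None by move/eqP: ar => ->.
apply: proper_card; apply/properP; split.
  by apply/fintype.subsetP => m; rewrite !inE => /connect_trans; apply;
    exact: connect1.
exists k; rewrite !inE ?connect0 //; apply/negP => /connectP[p pth li].
have := @dlabel_acyclic _ D (k :: p).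
by rewrite /= rcons_path pth -li => /(_ eik).
Qed.

(** Each bracket moves coordinates along an arrow and so adds at least one ancestor; the induction
    follows the second factor, which lies in the previous term of the series. *)
Lemma lower_central_sub d x k :
  x \in lower_central (tensor_bracket c) d -> x 0 k != 0 ->
  (d <= #|ancestors k|)%N.
Proof.
elim: d x k => [//|d IH] x k /=.
set X := [seq _ | _ <- _, _ <- _] => xX.
rewrite (@coord_span _ _ _ (in_tuple X) x xX) => nz.
have [i] : exists i : 'I_(size X), (X`_i) 0 k != 0.
  apply/existsP; apply: contraNT nz; rewrite negb_exists => /forallP z.
  rewrite summxE big1 // => i _; rewrite mxE.
  by have := z i; rewrite negbK => /eqP ->; rewrite mulr0.
have /allpairsP[[u v] /= [_ /vbasis_mem vin ->]] : X`_i \in X by exact: mem_nth.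
rewrite mxE oppr_eq0 form2E => nzs.
have /existsP[a /existsP[b]] : [exists a, exists b, u 0 a * c k a b * v 0 b !=
  0].
  apply: contraNT nzs; rewrite negb_exists => /forallP z.
  rewrite big1 // => a _; rewrite big1 // => b _; apply/eqP.
  by have := z a; rewrite negb_exists => /forallP/(_ b); rewrite negbK.
rewrite !mulf_eq0 !negb_or => /andP[/andP[_ cn] vn].
(* The induction hypothesis concerns [v], so the arrow is turned to start at [b]. *)
case: fc => _ supp; rewrite supp arrowC in cn.
exact: leq_ltn_trans (IH _ _ vin vn) (ancestors_arrow cn).
Qed.

Lemma tensor_nilpotent : nilpotent_lie (tensor_bracket c).
Proof.
(* A node has at most [n] ancestors, itself included, so no coordinate survives in the term
   [n.+1]. *)
exists n.+1; apply/eqP; rewrite -subv0; apply/subvP => x xin.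
rewrite memv0; apply/eqP/rowP => k; rewrite mxE; apply/eqP.
apply: contraT => /(lower_central_sub xin).
by rewrite leqNgt ltnS (leq_trans (max_card _)) ?card_ord.
Qed.

End Nilpotent.

(** * Nice basis and diagram of a tensor bracket *)

Lemma std_basisE i : tnth (std_basis R n) i = delta_mx 0 i.
Proof. by rewrite tnth_mktuple. Qed.

Lemma std_basis_sum (x : 'rV[R]_n) : x = \sum_i x 0 i *: (std_basis R n)`_i.
Proof.
rewrite {1}[x]row_sum_delta; apply: eq_bigr => i _.
by rewrite -tnth_nth std_basisE.
Qed.

Lemma std_basis_is_basis : basis_of fullv (std_basis R n).
Proof.
rewrite basisEdim; apply/andP; split.
  apply/subvP => x _; rewrite [x]std_basis_sum; apply: memv_suml => i _.
  by rewrite memvZ // memv_span // mem_nth // size_tuple.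
by rewrite dimvf size_tuple /dim /= mul1n.
Qed.

Lemma coord_std_basis i (x : 'rV[R]_n) : coord (std_basis R n) i x = x 0 i.
Proof.
have fr := basis_free std_basis_is_basis.
by rewrite {1}[x]std_basis_sum coord_sum_free.
Qed.

Lemma tensor_nice c : full_support c -> nice_basis (tensor_bracket c)
  (std_basis R n).
Proof.
move=> fc; split; first exact: std_basis_is_basis.
  move=> i j; rewrite !std_basisE.
  have [[k ar]|na] := pselect (exists k, arrow D i j k).
    exists k, (- c k i j); rewrite std_basisE; exact: tensor_bracket_arrow.
  (* Without an arrow the bracket vanishes, so the basis index is arbitrary. *)
  exists i, 0; rewrite scale0r tensor_bracket_noarrow // => k.
  by apply/negP => ar; apply: na; exists k.
move=> i j; rewrite std_basisE.
have E y : ce_d (tensor_bracket c) (coord (std_basis R n) j) (delta_mx 0 i) y =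
    \sum_h c j i h * y 0 h.
  rewrite /ce_d coord_std_basis mxE opprK form2E (bigD1 i) //= [X in _ + X]big1.
    by rewrite addr0; apply: eq_bigr => h _; rewrite mxE !eqxx mul1r.
  by move=> a ai; rewrite big1 // => h _; rewrite mxE (negPf ai) !mul0r.
(* An arrow from [i] to [j] has only one label, so at most one term of this sum is nonzero. *)
have [[h ar]|na] := pselect (exists h, arrow D i h j).
  exists h, (c j i h) => y; rewrite E coord_std_basis (bigD1 h) //= big1 ?addr0
    //.
  move=> h' hh'; rewrite (@full_support0 c) ?mul0r //.
  by apply/negP => /(arrow_label_inj ar) hE; rewrite hE eqxx in hh'.
exists j, 0 => y; rewrite E mul0r big1 // => h _.
rewrite (@full_support0 c) ?mul0r //; apply/negP => ar; apply: na; by exists h.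
Qed.

Lemma tensor_nice_nilpotent c : full_support c -> jacobi_equations c ->
  nice_nilpotent (tensor_bracket c) (std_basis R n).
Proof.
move=> fc jac; have [sk _] := fc.
split; [|exact: tensor_nilpotent|exact: tensor_nice].
split; [exact: tensor_bracket_linearl|exact: tensor_bracket_linearr| |].
  by move=> x; exact: tensor_bracket_alternating.
exact/(jacobi_equationsP sk).
Qed.

Lemma tensor_has_diagram c : full_support c ->
  has_diagram (tensor_bracket c) (std_basis R n) D.
Proof.
move=> fc; have [_ supp] := fc; exists D; split; last first.
  exists id; split; first by exists id.
  by move=> i k; case: dlabel.
move=> i h j; rewrite !std_basisE; split=> [ar|[a [a0 E]]].
  exists (- c j i h)^-1; rewrite invr_eq0 oppr_eq0 supp; split=> //.
  by rewrite (tensor_bracket_arrow fc ar) scalerA mulVf ?scale1r // oppr_eq0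
    supp.
rewrite -supp; apply/eqP => c0.
move/rowP/(_ j): E; rewrite [in RHS]mxE tensor_bracket_delta c0 oppr0 mulr0.
by rewrite mxE !eqxx => /eqP; rewrite oner_eq0.
Qed.

End Support.

(** * Diagonal normalization *)

Section RowVectors.
Variables (F : fieldType) (n : nat).

(** Pairing of a root row with exponents: logarithms of absolute values over the reals, sign bits
    over ['F_2]. *)
Definition dot (v : 'rV[F]_n) (x : 'I_n -> F) : F := \sum_m v 0 m * x m.

Lemma dot_suml (I : finType) (a : I -> F) (v : I -> 'rV[F]_n) x :
  dot (\sum_i a i *: v i) x = \sum_i a i * dot (v i) x.
Proof.
rewrite /dot; under eq_bigr => m _ do rewrite summxE mulr_suml.
rewrite exchange_big; apply: eq_bigr => i _; rewrite mulr_sumr.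
by apply: eq_bigr => m _; rewrite mxE mulrA.
Qed.

Lemma dotB (v : 'rV[F]_n) x y : dot v (fun m => x m - y m) = dot v x - dot v y.
Proof. by rewrite /dot -sumrB; apply: eq_bigr => m _; rewrite mulrBr. Qed.

(** Independent functionals can be given arbitrary values simultaneously. *)
Lemma free_dot_surj (T : finType) (f : T -> 'rV[F]_n) (J : {set T}) (s : T ->
  F) :
  free [seq f t | t <- enum J] ->
  exists x, forall t, t \in J -> dot (f t) x = s t.
Proof.
set X := in_tuple [seq f t | t <- enum J] => freeX.
have szX : size X = size (enum J) by rewrite size_map.
pose u i := nth 0 [seq s t | t <- enum J] i.
(* Pairing with this vector is the linear form combining the coordinates along [X] with weights
   [u i]; it sends the i-th vector of [X] to [u i]. *)
exists (fun m => \sum_(i < size X) coord X i (delta_mx 0 m) * u i) => t tJ.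
have tlt : (index t (enum J) < size X)%N by rewrite szX index_mem mem_enum.
have -> : dot (f t) (fun m => \sum_(i < size X) coord X i (delta_mx 0 m) * u i)
  =
    \sum_(i < size X) coord X i (f t) * u i.
  rewrite /dot; under eq_bigr => m _ do rewrite mulr_sumr.
  rewrite exchange_big; apply: eq_bigr => i _.
  rewrite {2}[f t]row_sum_delta linear_sum mulr_suml; apply: eq_bigr => m _.
  by rewrite linearZ mulrA.
have tE : nth t (enum J) (index t (enum J)) = t by rewrite nth_index ?mem_enum.
have -> : f t = X`_(Ordinal tlt) by rewrite /= (nth_map t) ?tE ?index_mem
  ?mem_enum.
rewrite (bigD1 (Ordinal tlt)) // coord_free // eqxx mul1r big1.
  by rewrite /= /u (nth_map t) ?tE ?index_mem ?mem_enum // addr0.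
by move=> i ni; rewrite coord_free // eq_sym (negPf ni) mul0r.
Qed.

Lemma span_dot0 (X : seq 'rV[F]_n) v x :
  v \in <<X>>%VS -> {in X, forall u, dot u x = 0} -> dot v x = 0.
Proof.
move=> vX X0; rewrite (@coord_span _ _ _ (in_tuple X) v vX) dot_suml big1 // =>
  i _.
by rewrite X0 ?mulr0 ?mem_nth.
Qed.

End RowVectors.

Section RootRows.
Variables (n : nat) (D : labeled_diagram 'I_n).
Hypothesis niceD : nice_diagram D.
Implicit Types (I : root_index D).

Definition root_row (F : fieldType) I : 'rV[F]_n :=
  row (enum_rank I) (map_mx intr (root_matrix D)).

(** The three nodes are distinct, by acyclicity, (N3) and the order of the sources, so no two
    entries of the row collide. The value is the additive form of the character
    [g k / (g i * g j)]. *)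
Lemma dot_root_row (F : fieldType) I (x : 'I_n -> F) :
  dot (root_row F I) x = x (tgt I) - x (src1 I) - x (src2 I).
Proof.
have ar := arrow_root I; have lt := src_lt I.
have n1 : src1 I != tgt I by rewrite eq_sym (arrow_src_neq ar).
have n2 : src2 I != tgt I by rewrite arrowC // in ar;
  rewrite eq_sym (arrow_src_neq ar).
have n3 : src2 I != src1 I by rewrite -val_eqE gtn_eqF.
have E m : root_row F I 0 m = if m == tgt I then 1 else
    if (m == src1 I) || (m == src2 I) then -1 else 0.
  rewrite !mxE enum_rankK; do 2?case: ifP => _; first exact: rmorph1.
    by rewrite rmorphN1.
  exact: rmorph0.
rewrite /dot (bigD1 (tgt I)) //= E eqxx mul1r (bigD1 (src1 I)) //= E (negPf n1)
  eqxx /=.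
rewrite (bigD1 (src2 I)) /= ?n2 // E (negPf n2) eqxx orbT big1.
  by rewrite !mulN1r addr0 addrA.
by move=> m /andP[/andP[m1 m2] m3]; rewrite E (negPf m1) (negPf m2) (negPf m3)
  mul0r.
Qed.

(** By maximality a row outside [J] lies in the span of the rows in [J]; otherwise adding it would
    keep the family free. *)
Lemma max_independent_dot0 (F : fieldType) (J : {set root_index D}) (x :
  'I_n -> F) :
  max_independent_rows F J -> (forall I, I \in J -> dot (root_row F I) x = 0) ->
  forall I, dot (root_row F I) x = 0.
Proof.
move=> /maxsetP[frJ mxJ] J0 I; have [/J0 //|nIJ] := boolP (I \in J).
have nfr : ~~ rows_independent F (I |: J).
  apply/negP => /mxJ/(_ (subsetU1 I J)) E.
  by move: nIJ; rewrite -E setU11.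
apply: (@span_dot0 _ _ [seq root_row F t | t <- enum J]); last first.
  by move=> _ /mapP[t tJ ->]; apply: J0; rewrite mem_enum in tJ.
apply: contraNT nfr => nspan; rewrite /rows_independent.
rewrite (@perm_free _ _ _ (root_row F I :: [seq root_row F t | t <- enum J])).
  by rewrite free_cons nspan.
rewrite -map_cons; apply: perm_map; apply: uniq_perm; first exact: enum_uniq.
  by rewrite /= mem_enum nIJ enum_uniq.
by move=> t; rewrite inE !mem_enum !inE.
Qed.

End RootRows.

(** * Signs over ['F_2] and normal forms of diagonal orbits *)

Section Signs.
Variable R : realType.

(** Isomorphism from the additive group of ['F_2] onto the signs, which makes sign changes
    linear. *)
Definition sign2 (y : 'F_2) : R := (-1) ^+ (y : nat).

Lemma F2_cases (y : 'F_2) : y = 0 \/ y = 1.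
Proof.
by case: y => [[|[|m]] i] //; [left|right]; apply: val_inj.
Qed.

Lemma sign2_cases y : sign2 y = 1 \/ sign2 y = -1.
Proof. by case: (F2_cases y) => ->; [left|right]. Qed.

Lemma sign2B x y : sign2 (x - y) = sign2 x * sign2 y.
Proof.
case: (F2_cases x) => ->; case: (F2_cases y) => ->;
  rewrite /sign2 /= ?expr0 ?expr1 ?mulr1 ?mul1r //.
by rewrite mulrNN mulr1.
Qed.

Lemma sign2_inj : injective sign2.
Proof.
have n1 : (1 : R) != -1 by rewrite eq_sym -subr_eq0 -opprD oppr_eq0 paddr_eq0
  ?ler01 // oner_eq0.
move=> x y; case: (F2_cases x) => ->; case: (F2_cases y) => ->;
  rewrite /sign2 //= expr0 expr1 => /eqP.
  by rewrite (negPf n1).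
by rewrite eq_sym (negPf n1).
Qed.

Lemma sign2_neq0 y : sign2 y != 0.
Proof. by rewrite signr_eq0. Qed.

Lemma sgr_sign2 (x : R) : x != 0 -> Num.sg x = sign2 (x < 0)%R%:R.
Proof.
by move=> x0; rewrite sgr_def x0 mulr1n; case: (x < 0).
Qed.

Variables (n : nat) (D : labeled_diagram 'I_n).
Hypothesis niceD : nice_diagram D.
Implicit Types (c : tensor R n) (I : root_index D) (J : {set root_index D}).

Lemma sgr_coef_diag g c I : (forall i, g i != 0) ->
  Num.sg (coef (diag_act g c) I) =
  sign2 (dot (root_row 'F_2 I) (fun m => (g m < 0)%R%:R)) * Num.sg (coef c I).
Proof.
move=> g0; rewrite coef_diag !sgrM sgrV sgrM !(sgr_sign2 (g0 _)).
by rewrite (dot_root_row niceD) !sign2B !mulrA.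
Qed.

(** The sign bits of [g] and [g'] differ by a vector that pairs to zero with the rows in [J2], hence
    with all rows by maximality; so both diagonal matrices change every sign alike. *)
Lemma sign_rigid J2 g g' c c' : max_independent_rows 'F_2 J2 ->
  full_support D c -> full_support D c' ->
  (forall i, g i != 0) -> (forall i, g' i != 0) ->
  (forall I, Num.sg (coef c I) = Num.sg (coef c' I)) ->
  (forall I, I \in J2 -> coef (diag_act g c) I = coef (diag_act g' c') I) ->
  forall I, Num.sg (coef (diag_act g c) I) = Num.sg (coef (diag_act g' c') I).
Proof.
move=> mxJ2 fc fc' g0 g0' sgE gE I; rewrite !sgr_coef_diag // -sgE.
congr (sign2 _ * _); apply/eqP; rewrite -subr_eq0.
pose x m : 'F_2 := (g m < 0)%R%:R; pose x' m : 'F_2 := (g' m < 0)%R%:R.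
have dB K : dot (root_row 'F_2 K) (fun m => x m - x' m) =
    dot (root_row 'F_2 K) x - dot (root_row 'F_2 K) x'.
  exact: dotB.
rewrite -dB; apply/eqP; move: I; apply: (max_independent_dot0 mxJ2) => I IJ2.
rewrite dB; apply/eqP; rewrite subr_eq0; apply/eqP/sign2_inj.
have := congr1 Num.sg (gE I IJ2); rewrite !sgr_coef_diag // -sgE.
by apply: mulIf; rewrite sgr_eq0 coef_neq0.
Qed.

(** A positive diagonal matrix first makes the coefficients in [J] equal to 1 or -1; a matrix of
    signs then makes those in [J2] equal to 1 without disturbing absolute values. *)
Lemma normalize J2 J c : J2 \subset J -> rows_independent 'F_2 J2 ->
  rows_independent R J -> full_support D c ->
  exists2 g, (forall i, g i != 0) & W_open J2 J (diag_act g c).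
Proof.
move=> sJ fr2 fr fc.
have [x xE] := free_dot_surj (fun I => - ln `|coef c I|) fr.
pose g i := expR (x i); have g0 i : g i != 0 by rewrite gt_eqF ?expR_gt0.
have coefg I : I \in J -> coef (diag_act g c) I = Num.sg (coef c I).
  move=> IJ; rewrite coef_diag /g -expRD -expRN -expRD opprD addrA.
  rewrite -(dot_root_row niceD) [dot _ _]xE // expRN lnK ?posrE ?normr_gt0
    ?coef_neq0 //.
  rewrite {2}[coef c I]numEsg mulrCA mulVf ?mulr1 // normr_eq0 coef_neq0 //.
set c1 := diag_act g c in coefg.
have fc1 : full_support D c1 by exact: full_support_diag.
(* On [J2] the bits of [y] reproduce the signs of [c], so multiplying by them squares these signs
   away. *)
have [y yE] := free_dot_surj (fun I => (coef c I < 0)%R%:R) fr2.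
pose h i := sign2 (y i); have h0 i : h i != 0 by exact: sign2_neq0.
have coefh I : coef (diag_act h c1) I = sign2 (dot (root_row 'F_2 I) y) * coef
  c1 I.
  rewrite coef_diag (dot_root_row niceD) !sign2B /h; congr (_ * _).
  (* The values of [h] are 1 or -1, so each is its own inverse. *)
  rewrite -mulrA; congr (_ * _); rewrite invfM /sign2.
  by rewrite -!exprVn invrN invr1.
exists (fun i => h i * g i); first by move=> i; rewrite mulf_neq0.
rewrite -diag_actM; apply/(W_openP niceD); split;
  first exact: full_support_diag.
  move=> I IJ2; rewrite coefh [dot _ _]yE // coefg ?(fintype.subsetP sJ) //.
  by rewrite sgr_sign2 ?coef_neq0 // -sign2B subrr.
move=> I; rewrite inE => /andP[_ IJ]; rewrite coefh coefg // sgr_sign2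
  ?coef_neq0 //.
by rewrite -sign2B; exact: sign2_cases.
Qed.

End Signs.

(** * Connected components *)

Section Topology.
Variables (R : realType) (n : nat).

(** The pointwise topology is the supremum of the topologies induced by the evaluations, so these
    can be tested one at a time. *)
Lemma ptws_continuous (T : topologicalType) (I : eqType) (U : topologicalType)
    (f : T -> {ptws I -> U}) :
  (forall i, continuous (fun t => f t i)) -> continuous f.
Proof.
move=> cf t; apply/cvg_sup => i; apply/cvg_image.
  by rewrite eqEsubset; split=> v // _; exists (fun=> v).
move=> W Wf; exists (@^~ i @^-1` W); first exact: (cf i t W Wf).
by rewrite eqEsubset; split => [j [? + <-//]|j Wj]; exists (fun _ => j).
Qed.

Lemma matrix_continuous (T : topologicalType) (m p : nat) (f : T ->
  'M[R]_(m, p)) :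
  (forall i j, continuous (fun t => f t i j)) -> continuous f.
Proof.
move=> cf t W /nbhs_ballP[e e0 eW]; rewrite nbhs_simpl /=.
have : \forall s \near t, forall i j, ball (f t i j) e (f s i j).
  apply: filter_forall => i; apply: filter_forall => j.
  by apply: (cf i j t); exact: nbhsx_ballx.
by apply: filterS => s bs; apply: eW; split.
Qed.

Lemma entry_continuous k i j :
  continuous (fun c : {ptws 'I_n -> 'M[R]_n} => c k i j).
Proof.
move=> c; apply: (@continuous_comp _ _ _ (fun c : {ptws 'I_n -> 'M[R]_n} => c k)
  (fun M : 'M[R]_n => M i j)); first exact: proj_continuous.
exact: coord_continuous.
Qed.

(** Intermediate values: the image of [C] is an interval that misses 0. *)
Lemma connected_sgr (T : topologicalType) (C : set T) (f : T -> R) x y :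
  connected C -> continuous f -> (forall z, C z -> f z != 0) -> C x -> C y ->
  Num.sg (f x) = Num.sg (f y).
Proof.
move=> cC cf f0.
have itv : is_interval (f @` C).
  by apply/connected_intervalP/connected_continuous_connected => //;
    exact: continuous_subspaceT.
wlog xy : x y / f x <= f y => [W Cx Cy|Cx Cy].
  by have [/W|/ltW/W] := leP (f x) (f y); first exact; move/(_ Cy Cx).
have [fx0|fx0|fx0] := ltgtP (f x) 0; last by have := f0 x Cx; rewrite fx0 eqxx.
  have [fy0|fy0|fy0] := ltgtP (f y) 0; last by have := f0 y Cy;
    rewrite fy0 eqxx.
    by rewrite !ltr0_sg.
  have [z Cz fz] : (f @` C) 0.
    by apply: (itv (f x) (f y)); [exists x|exists y|rewrite !ltW].
  by have := f0 z Cz; rewrite fz eqxx.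
by rewrite !gtr0_sg // (lt_le_trans fx0 xy).
Qed.

Variables (D : labeled_diagram 'I_n) (J2 J : {set root_index D}).
Hypothesis niceD : nice_diagram D.

Lemma segment_neq0 (a b t : R) : Num.sg a = Num.sg b -> a != 0 -> 0 <= t <= 1 ->
  (1 - t) * a + t * b != 0.
Proof.
move=> sab a0 /andP[t0 t1]; have b0 : b != 0 by rewrite -sgr_eq0 -sab sgr_eq0.
case: (ltgtP a 0) a0 => // [aneg|apos] _.
  have bneg : b < 0 by rewrite -sgr_lt0 -sab sgr_lt0.
  by apply: ltr0_neq0; nra.
have bpos : 0 < b by rewrite -sgr_gt0 -sab sgr_gt0.
by apply: lt0r_neq0; nra.
Qed.

Lemma sgr_entry (c c' : tensor R n) k i j :
  full_support D c -> full_support D c' ->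
  (forall I : root_index D, Num.sg (coef c I) = Num.sg (coef c' I)) ->
  Num.sg (c k i j) = Num.sg (c' k i j).
Proof.
move=> fc fc' sg; have [ar|na] := boolP (arrow D i j k); last first.
  by rewrite (full_support0 fc) // (full_support0 fc').
case: (ltngtP i j) => [ij|ji|/val_inj ij].
- by have [I [<- <- <-]] := root_indexE ij ar; exact: sg.
- rewrite arrowC // in ar; rewrite (fc.1) (fc'.1) !sgrN; congr (- _).
  by have [I [<- <- <-]] := root_indexE ji ar; exact: sg.
- by have := arrow_neq niceD ar; rewrite ij eqxx.
Qed.

(** Coefficients are continuous and nonzero on [W_open], so signs are constant on components;
    conversely the segment between two points with equal signs stays in [W_open]. *)
Lemma W_componentP c c' : W_open J2 J c ->
  @connected_component {ptws 'I_n -> 'M[R]_n} (W_open J2 J) c c' <->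
  W_open J2 J c' /\
  forall I : root_index D, Num.sg (coef c I) = Num.sg (coef c' I).
Proof.
move=> Wc; split=> [[C [Cc CW cC] Cc']|[Wc' sg]].
  split=> [|I]; first exact: CW.
  apply: (connected_sgr (f := fun d : {ptws 'I_n ->
    'M[R]_n} => d (tgt I) (src1 I) (src2 I)) cC) => //.
    exact: entry_continuous.
  by move=> z /CW/(W_openP niceD)[fz _ _]; exact: (coef_neq0 I fz).
pose g (t : R) : {ptws 'I_n -> 'M[R]_n} := fun k => (1 - t) *: c k + t *: c' k.
have gE t k i j : g t k i j = (1 - t) * c k i j + t * c' k i j by rewrite !mxE.
have cg : continuous g.
  apply: ptws_continuous => k; apply: matrix_continuous => i j t.
  rewrite (_ : (fun _ => _) = (fun t => (1 - t) * c k i j + t * c' k i j));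
    last first.
    by apply/funext => s; rewrite gE.
  apply: cvgD; apply: cvgM; [|exact: cvg_cst|exact: cvg_id|exact: cvg_cst].
  by apply: cvgB; [exact: cvg_cst|exact: cvg_id].
have /(W_openP niceD)[fc c1 c2] := Wc; have /(W_openP niceD)[fc' c1' c2'] :=
  Wc'.
have g0E : g 0 = c by apply/funext => k; rewrite /g subr0 scale0r addr0 scale1r.
have g1E : g 1 = c' by apply/funext => k; rewrite /g subrr scale0r add0r
  scale1r.
exists (g @` `[0, 1]); last by exists 1; rewrite //= in_itv /= ler01 lexx.
split.
- by exists 0; rewrite //= in_itv /= ler01 lexx.
- move=> _ [t + <-]; rewrite /= in_itv /= => t01; apply/(W_openP niceD).
  split; first split.
  + by move=> k i j; rewrite !gE fc.1 fc'.1; ring.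
  + move=> k i j; rewrite gE; have [ar|na] := boolP (arrow D i j k); last first.
      by rewrite (full_support0 fc) // (full_support0 fc') // !mulr0 addr0 eqxx.
    by apply: segment_neq0; [exact: sgr_entry|rewrite fc.2|].
  + by move=> I I2; rewrite /coef gE [c _ _ _]c1 // [c' _ _ _]c1' // !mulr1
      subrK.
  + move=> I IJ; rewrite /coef gE -!/(coef _ _).
    (* Values in {1, -1} with the same sign coincide, so this coordinate is constant along the
       segment. *)
    have E : coef c I = coef c' I.
      have := sg I; case: (c2 I IJ) => ->; case: (c2' I IJ) => -> //;
      by rewrite sgrN sgr1 => /eqP; rewrite ?(eq_sym (-1)) -subr_eq0 opprK
        paddr_eq0 ?ler01 // oner_eq0.
    rewrite -E -mulrDl subrK mul1r; exact: c2.
- by apply: connected_continuous_connected;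
    [exact: segment_connected|exact: continuous_subspaceT].
Qed.

End Topology.

(** * Equivalences *)

Section AutImage.
Variables (R : realType) (n : nat) (D : labeled_diagram 'I_n).
Variables (J2 J : {set root_index D}).
Hypotheses (niceD : nice_diagram D) (sJ : J2 \subset J).
Hypotheses (mxJ2 : max_independent_rows 'F_2 J2) (mxJ :
  max_independent_rows R J).
Implicit Types (c w : tensor R n) (s : 'S_n).

(** The normalized image has signs that depend only on those of the point, whichever diagonal
    matrices normalize: this is [sign_rigid] after permutation. *)
Lemma sgr_aut s (g g' : 'I_n -> R) c c' : diagram_aut D s ->
  W_open J2 J c -> W_open J2 J c' ->
  (forall i, g i != 0) -> (forall i, g' i != 0) ->
  W_open J2 J (diag_act g (perm_act s c)) ->
  W_open J2 J (diag_act g' (perm_act s c')) ->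
  (forall I : root_index D, Num.sg (coef c I) = Num.sg (coef c' I)) ->
  forall I : root_index D, Num.sg (coef (diag_act g (perm_act s c)) I) =
    Num.sg (coef (diag_act g' (perm_act s c')) I).
Proof.
move=> As /(W_openP niceD)[fc _ _] /(W_openP niceD)[fc' _ _] g0 g0'.
move=> /(W_openP niceD)[_ c1 _] /(W_openP niceD)[_ c1' _] sg.
apply: (sign_rigid niceD mxJ2) => //; do ?exact: full_support_perm.
  (* The permutation may reverse the order of the sources, so signs are compared at all entries. *)
  by move=> I; rewrite /coef !mxE; exact: (sgr_entry niceD).
by move=> I IJ2; rewrite c1 ?c1'.
Qed.

(** Components are sign classes, so a single point [w] sent into [C'] decides the whole image.
    Surjectivity comes from applying the inverse automorphism and normalizing. *)
Lemma aut_image_component s (g : 'I_n -> R) (C C' : set (tensor R n)) w :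
  diagram_aut D s -> (forall i, g i != 0) ->
  is_component (W_open J2 J) C -> is_component (W_open J2 J) C' ->
  C w -> C' (diag_act g (perm_act s w)) -> aut_image J2 J s C = C'.
Proof.
move=> As g0 [c0 Wc0 ->] [c0' Wc0' ->] Cw Cw'; set w' := diag_act g _ in Cw'.
rewrite (same_connected_component Cw) (same_connected_component Cw').
have Ww : W_open J2 J w by exact: (connected_component_sub Cw).
have Ww' : W_open J2 J w' by exact: (connected_component_sub Cw').
apply/seteqP; split=> [v' [Wv' [v /(W_componentP niceD _ Ww)[Wv sg] [h h0
  v'E]]]|v'].
  apply/(W_componentP niceD _ Ww'); split=> // I.
  by rewrite v'E in Wv' *; exact: sgr_aut.
move=> /(W_componentP niceD _ Ww')[Wv' sg]; split=> //.
have As' := diagram_autV As.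
have [fr2 _] := maxsetP mxJ2; have [fr _] := maxsetP mxJ.
have fv' : full_support D v' by have /(W_openP niceD)[] := Wv'.
have [h h0 Wv] := normalize niceD sJ fr2 fr (full_support_perm As' fv').
exists (diag_act h (perm_act (s^-1)%g v')); last first.
  exists (fun i => (h ((s^-1)%g i))^-1); first by move=> i; rewrite invr_neq0.
  by rewrite perm_diag_act perm_actKV diag_actK.
(* Writing [w] as an image of [w'] under the inverse automorphism lets [sgr_aut] compare it with the
   preimage of [v']. *)
have wE : w = diag_act (fun i => (g (s i))^-1) (perm_act (s^-1)%g w').
  rewrite /w' perm_diag_act perm_actK invgK diag_actK //.
apply/(W_componentP niceD _ Ww); split=> // I; rewrite [in LHS]wE.
apply: sgr_aut => //; first by move=> i; rewrite invr_neq0.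
by rewrite -wE.
Qed.

End AutImage.

(** * Transport of structure along a monomial map *)

Section Transport.
Variable R : realType.

Lemma linear_sumE (U V : lmodType R) (f : U -> V) (I : finType) (a : I -> R)
    (v : I -> U) : linear f -> f (\sum_i a i *: v i) = \sum_i a i *: f (v i).
Proof.
move=> lf; pose F : {linear U -> V} := HB.pack f
  (GRing.isLinear.Build R U V *:%R f lf).
rewrite -[f]/(F : U -> V) linear_sum; apply: eq_bigr => i _; exact: linearZ.
Qed.

Lemma coord_tnth m (V : vectType R) (e : m.-tuple V) i j : free e ->
  coord e i (tnth e j) = (j == i)%:R.
Proof. by move=> fe; rewrite (tnth_nth 0) coord_free. Qed.

Variables (n m : nat) (V : vectType R) (br : V -> V -> V) (e : m.-tuple V).
Variables (p : 'I_n -> 'I_m) (c w : tensor R n) (a : 'I_n -> R) (s : 'S_n).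
Hypotheses (brL : lie_bracket br) (eB : basis_of fullv e) (pB : bijective p).
Hypothesis brE : forall i j,
  br (tnth e (p i)) (tnth e (p j)) = \sum_k - c k i j *: tnth e (p k).
Hypotheses (a0 : forall i, a i != 0) (wS : skew_tensor w).
Hypothesis wE : forall k i j, w k i j * a k = a i * a j * c (s k) (s i) (s j).

(** Comparing structure constants, [wE] is the condition for this map to preserve brackets. *)
Let fmap (x : 'rV[R]_n) := \sum_i (x 0 i * a i) *: tnth e (p (s i)).

Let fmap_linear : linear fmap.
Proof.
move=> l x y; rewrite /fmap scaler_sumr -big_split; apply: eq_bigr => i _ /=.
by rewrite !mxE mulrDl scalerDl scalerA mulrA.
Qed.

Let finv (v : V) : 'rV[R]_n := \row_i (coord e (p (s i)) v / a i).

Let ps_inj : injective (p \o s).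
Proof. by apply: inj_comp; [exact: bij_inj|exact: perm_inj]. Qed.

Let fmapK : cancel fmap finv.
Proof.
move=> x; apply/rowP => i; rewrite mxE /fmap linear_sum (bigD1 i) //= big1 =>
  [|j ji].
  by rewrite linearZ /= coord_tnth ?(basis_free eB) // eqxx mulr1 addr0 mulfK.
rewrite linearZ /= coord_tnth ?(basis_free eB) //.
by rewrite (inj_eq ps_inj) (negPf ji) mulr0.
Qed.

Let finvK : cancel finv fmap.
Proof.
move=> v; rewrite {2}(coord_basis eB (memvf v)) (reindex (p \o s)) /=;
  last first.
  by apply: onW_bij; apply: bij_comp => //; apply: injF_bij; exact: perm_inj.
by apply: eq_bigr => i _; rewrite mxE divfK // (tnth_nth 0).
Qed.

Let fmap_bracket x y : fmap (tensor_bracket w x y) = br (fmap x) (fmap y).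
Proof.
have [ll lr _ _] := brL; rewrite /fmap (linear_sumE _ _ (ll _)).
transitivity (\sum_i \sum_j \sum_k
   (- (x 0 i * w k i j * y 0 j * a k)) *: tnth e (p (s k))).
  under [RHS]eq_bigr => i _ do rewrite exchange_big /=.
  rewrite exchange_big; apply: eq_bigr => k _.
  rewrite mxE form2E mulNr mulr_suml -sumrN scaler_suml; apply: eq_bigr => i _.
  rewrite mulr_suml -sumrN scaler_suml; exact: eq_bigr.
apply: eq_bigr => i _; rewrite (linear_sumE _ _ (lr _)) scaler_sumr.
apply: eq_bigr => j _; rewrite brE [in RHS](reindex_inj (@perm_inj _ s)) /=
  !scaler_sumr.
apply: eq_bigr => k _; rewrite !scalerA; congr (_ *: _).
transitivity (- (x 0 i * y 0 j * (w k i j * a k))); first by ring.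
by rewrite wE; ring.
Qed.

(** The Jacobi identity pulls back along an injective linear map that preserves brackets. *)
Lemma transport_jacobi : jacobi_equations w.
Proof.
apply/(jacobi_equationsP wS) => x y z; apply: (can_inj fmapK).
have fD u v : fmap (u + v) = fmap u + fmap v.
  by have := fmap_linear 1 u v; rewrite !scale1r.
have f0 : fmap 0 = 0 by rewrite /fmap big1 // => i _; rewrite mxE mul0r scale0r.
by rewrite !fD !fmap_bracket f0; have [_ _ _ ->] := brL.
Qed.

Lemma transport_equivalent :
  nice_equivalent (tensor_bracket w) (std_basis R n) br e.
Proof.
pose F : {linear 'rV[R]_n -> V} :=
  HB.pack fmap (GRing.isLinear.Build R 'rV[R]_n V *:%R fmap fmap_linear).
have FE x : linfun F x = fmap x by rewrite lfunE.
exists (linfun F); split.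
- by exists finv => x; rewrite FE; [exact: fmapK|exact: finvK].
- by move=> x y; rewrite !FE fmap_bracket.
- move=> i; exists (p (s i)), (a i); split=> //.
  rewrite FE std_basisE /fmap (bigD1 i) //= mxE !eqxx mul1r big1 ?addr0 // =>
    j ji.
  by rewrite mxE (negPf ji) mul0r scale0r.
Qed.

End Transport.

(** * Equivalences as automorphisms of the diagram followed by diagonal matrices *)

Section Equivalence.
Variables (R : realType) (n : nat) (D : labeled_diagram 'I_n).
Hypothesis niceD : nice_diagram D.
Implicit Types (c : tensor R n).

Lemma diagram_aut_arrow (s : 'S_n) :
  (forall i j k, arrow D i j k = arrow D (s i) (s j) (s k)) -> diagram_aut D s.
Proof.
move=> As; split; first by apply: injF_bij; exact: perm_inj.
move=> i k; case E: (dlabel D i k) => [j|].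
  by have := As i j k; rewrite /arrow E eqxx => /esym/eqP ->.
case E': (dlabel D (s i) (s k)) => [j|] //.
have := As i ((s^-1)%g j) k.
by rewrite /arrow E permKV E' eqxx.
Qed.

(** An equivalence is a monomial matrix. Its permutation part preserves the nonzero structure
    constants, hence the arrows; its coefficients give the diagonal part. *)
Lemma equivalent_orbit c c' : full_support D c -> full_support D c' ->
  nice_equivalent (tensor_bracket c) (std_basis R n)
    (tensor_bracket c') (std_basis R n) ->
  exists2 s : 'S_n, diagram_aut D s &
    exists2 g : 'I_n -> R, (forall i, g i != 0) & c' = diag_act g
      (perm_act s c).
Proof.
move=> fc fc' [f [bf hf mf]].
have /choice[q /choice[a qa]] : forall i, exists j a,
    a != 0 /\ f (delta_mx 0 i) = a *: (delta_mx 0 j : 'rV[R]_n).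
  by move=> i; have [j [a [a0]]] := mf i; rewrite !std_basisE; exists j, a.
have a0 i : a i != 0 by have [] := qa i.
have fE i : f (delta_mx 0 i) = a i *: delta_mx 0 (q i) by have [] := qa i.
have qI : injective q.
  move=> i j qij.
  (* If [q i = q j], these two multiples of different basis vectors would have the same image. *)
  have : f (a j *: delta_mx 0 i) = f (a i *: delta_mx 0 j).
    by rewrite !linearZ /= !fE qij !scalerA mulrC.
  move=> /(bij_inj bf)/rowP/(_ i); rewrite !mxE !eqxx mulr1.
  case: (eqVneq i j) => [//|_]; rewrite mulr0 => aj.
  by have := a0 j; rewrite aj eqxx.
pose s := perm qI; have sE i : s i = q i by rewrite permE.
have rel k i j : c k i j * a k = a i * a j * c' (s k) (s i) (s j).
  have := hf (delta_mx 0 i) (delta_mx 0 j); rewrite !fE tensor_bracketZZ.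
  rewrite [tensor_bracket c _ _]row_sum_delta linear_sum => /rowP/(_ (q k)).
  rewrite [X in _ = X]mxE tensor_bracket_delta summxE (bigD1 k) //= linearZ /=
    fE.
  rewrite tensor_bracket_delta !mxE !eqxx mulr1 mulrN mulNr big1.
    by rewrite addr0 => /oppr_inj ->; rewrite !sE.
  move=> l lk; rewrite linearZ /= fE !mxE (inj_eq qI) eq_sym (negPf lk).
  by rewrite !mulr0.
have As : diagram_aut D s.
  apply: diagram_aut_arrow => i j k; rewrite -(fc.2) -(fc'.2).
  have := congr1 (fun x => x != 0) (rel k i j).
  by rewrite !mulf_eq0 !negb_or !a0 andbT.
(* The diagonal matrix acts after the permutation, so the scalar of a node is indexed by its
   preimage. *)
exists s => //; exists (fun i => a ((s^-1)%g i)) => //.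
apply/funext => k; apply/matrixP => i j; rewrite !mxE.
set k' := (s^-1)%g k; set i' := (s^-1)%g i; set j' := (s^-1)%g j.
have aa : a i' * a j' != 0 by rewrite mulf_neq0.
by rewrite mulrAC [a k' * _]mulrC rel !permKV mulrAC divff // mul1r.
Qed.

Lemma basis_tensor m (V : vectType R) (br : V -> V -> V) (e : m.-tuple V) :
  nice_nilpotent br e -> has_diagram br e D ->
  exists (p : 'I_n -> 'I_m) c, [/\ bijective p, full_support D c &
    forall i j, br (tnth e (p i)) (tnth e (p j)) = \sum_k - c k i j *: tnth e
      (p k)].
Proof.
move=> [[ll lr la _] _ [eB nb _]] [D' [dD' [f [[p fK pK] fD]]]].
have bp : bijective p by exists f.
(* The map [p] inverts the isomorphism onto [D], and the minus sign is that of [tensor_bracket]. *)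
exists p, (fun k => \matrix_(i, j) - coord e (p k) (br (tnth e (p i)) (tnth e
  (p j)))).
have Darrow i j k : arrow D i j k = arrow D' (p i) (p j) (p k).
  rewrite /arrow -{1}[i]pK -{1}[j]pK -{1}[k]pK fD.
  by case: (dlabel D' _ _) => //= l; rewrite !(inj_eq (@Some_inj _))
    (inj_eq (can_inj fK)).
have coordE i j := coord_tnth i j (basis_free eB).
split=> //.
  split=> k i j; rewrite !mxE.
    rewrite opprK -linearN; congr (coord e _ _).
    set u := tnth e (p i); set v := tnth e (p j).
    have llD x y z : br (x + y) z = br x z + br y z.
      by have := ll z 1 x y; rewrite !scale1r.
    have lrD x y z : br z (x + y) = br z x + br z y.
      by have := lr z 1 x y; rewrite !scale1r.
    (* Polarizing the alternating law gives skewness. *)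
    have := la (u + v); rewrite llD !lrD !la add0r addr0 => /eqP.
    by rewrite addrC addr_eq0 => /eqP ->; rewrite ?opprK.
  rewrite oppr_eq0 Darrow; apply/idP/idP => [nz|/dD'[b [b0 E]]].
    (* The bracket is a multiple of one basis vector, so a nonzero coordinate at [p k] forces that
       vector to be [tnth e (p k)]. *)
    have [l [b E]] := nb (p i) (p j).
    rewrite E linearZ /= coordE in nz.
    have b0 : b != 0 by apply: contraNneq nz => ->; rewrite mul0r.
    have lk : l = p k by apply/eqP; apply: contraNT nz => /negPf ->;
      rewrite mulr0.
    by apply/dD'; exists b^-1; rewrite invr_eq0 b0 E lk scalerA mulVf ?scale1r.
  have := congr1 (coord e (p k)) E; rewrite coordE eqxx linearZ /= => one.
  by apply/eqP => z; move/eqP: one; rewrite z mulr0 oner_eq0.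
move=> i j; rewrite {1}(coord_basis eB (memvf (br _ _))) (reindex p) /=;
  last exact: onW_bij.
by apply: eq_bigr => k _; rewrite mxE opprK -tnth_nth.
Qed.

End Equivalence.

(** * Classification by orbits of components *)

Theorem theorem2p5 (R : realType) (n : nat) (D : labeled_diagram 'I_n)
    (J2 J : {set root_index D}) (r : nat) (Wc : 'I_r -> set (tensor R n)) :
  nice_diagram D ->
  J2 \subset J ->
  max_independent_rows 'F_2 J2 ->
  max_independent_rows R J ->
  (forall j, is_component (W_open J2 J) (Wc j)) ->
  (forall C, is_component (W_open J2 J) C ->
     exists j, same_orbit J2 J (Wc j) C) ->
  (forall j k, same_orbit J2 J (Wc j) (Wc k) -> j = k) ->
  [/\ forall j c, jacobi_subset (Wc j) c ->
        nice_nilpotent (tensor_bracket c) (std_basis R n) /\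
        has_diagram (tensor_bracket c) (std_basis R n) D,
      forall (m : nat) (V : vectType R) (br : V -> V -> V) (e : m.-tuple V),
        nice_nilpotent br e -> has_diagram br e D ->
        exists j c, jacobi_subset (Wc j) c /\
          nice_equivalent (tensor_bracket c) (std_basis R n) br e
    & forall j k c c', j != k ->
        jacobi_subset (Wc j) c -> jacobi_subset (Wc k) c' ->
        ~ nice_equivalent (tensor_bracket c) (std_basis R n)
            (tensor_bracket c') (std_basis R n)].
Proof.
move=> niceD sJ mxJ2 mxJ Wcomp Wrep Wuniq.
have Wfull j c : Wc j c -> full_support D c.
  have [c0 _ ->] := Wcomp j => /connected_component_sub.
  by case/(W_openP niceD).
split.
- move=> j c [/Wfull fc jac]; split.
    exact: (tensor_nice_nilpotent niceD fc jac).
  exact: (tensor_has_diagram niceD fc).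
- move=> m V br e nn hd; have [p [c [pB fc brE]]] := basis_tensor nn hd.
  have [fr2 _] := maxsetP mxJ2; have [fr _] := maxsetP mxJ.
  have [g g0 Ww] := normalize niceD sJ fr2 fr fc; set w := diag_act g c in Ww.
  (* The component of [w] is the image of some chosen component, so [w] comes from a point [w0] of
     it through [s] and a diagonal matrix [h]. *)
  have [j [s As imE]] := Wrep _ (ex_intro2 _ _ w Ww erefl).
  have : aut_image J2 J s (Wc j) w.
    by rewrite imE; exact: connected_component_refl.
  move=> [_ [w0 Cw0 [h h0 wE]]].
  have sk0 : skew_tensor w0 by have [] := Wfull _ _ Cw0.
  (* Since [w] is both [h] applied to the permuted [w0] and [g] applied to [c], passing from [w0] to
     [c] rescales by [h / g], read at the permuted node. *)
  pose a i := h (s i) / g (s i).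
  have a0 i : a i != 0 by rewrite mulf_neq0 ?invr_neq0.
  have rel k i l : w0 k i l * a k = a i * a l * c (s k) (s i) (s l).
    have /(congr1 (fun t : tensor R n => t (s k) (s i) (s l))) := wE.
    rewrite /w !mxE !permK => E.
    have -> : w0 k i l = h (s i) * h (s l) / h (s k) *
        (g (s k) / (g (s i) * g (s l)) * c (s k) (s i) (s l)).
      rewrite E; field; do ?[exact: h0]; by rewrite !h0.
    rewrite /a; field; by rewrite !h0 !g0.
  have [nnL _ [eB _ _]] := nn.
  exists j, w0; split.
    by split=> //; exact: (transport_jacobi nnL eB pB brE a0 sk0 rel).
  exact: (transport_equivalent nnL eB pB brE a0 rel).
- move=> j k c c' jk [Cc _] [Cc' _] eqv.
  have [s As [g g0 c'E]] := equivalent_orbit (Wfull _ _ Cc) (Wfull _ _ Cc') eqv.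
  (* The automorphism [s] carries one point of [Wc j] into [Wc k] up to a diagonal matrix, which
     puts the two components in one orbit. *)
  move/eqP: jk; apply; apply: Wuniq; exists s => //.
  rewrite c'E in Cc'.
  exact: (aut_image_component niceD sJ mxJ2 mxJ As g0 (Wcomp j) (Wcomp k) Cc
    Cc').
Qed.
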